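(* Let $(\mathcal{L},\circ_\lambda,\ast_\lambda)$ be a pre-Lie Poisson conformal superalgebra. Define $$[a_\lambda b]=a\ast_\lambda b-(-1)^{|a||b|}(b\ast_{-\partial-\lambda}a),\qquad\forall\,a,b\in\mathcal{L}.$$ Then $(\mathcal{L},\circ_\lambda,[\cdot_\lambda\cdot])$ is a transposed Poisson conformal superalgebra (TPCSA).
   Context: All vector spaces and linear maps are over $\mathbb{C}$. A $\mathbb{Z}_2$-graded $\mathbb{C}[\partial]$-module is a $\mathbb{C}[\partial]$-module $A=A_{\bar0}\oplus A_{\bar1}$ with $\partial A_i\subseteq A_i$; $|a|$ denotes the parity of a homogeneous element $a$. Whenever $|a|$ occurs, $a$ is assumed homogeneous, and the formula is extended by linearity. $A[\lambda]$ denotes polynomials in $\lambda$ with coefficients in $A$. A conformal superalgebra $(A,\circ_\lambda)$ is a $\mathbb{Z}_2$-graded $\mathbb{C}[\partial]$-module $A$ with a $\mathbb{C}$-bilinear map $A\otimes A\to A[\lambda]$, $a\otimes b\mapsto a\circ_\lambda b$, with $A_i\circ_\lambda A_j\subseteq A_{i+j}[\lambda]$, satisfying sesquilinearity: $(\partial a)\circ_\lambda b=-\lambda\, a\circ_\lambda b$, $a\circ_\lambda(\partial b)=(\partial+\lambda)(a\circ_\lambda b)$. Substitution convention: if $a\circ_\lambda b=\sum_n\lambda^n c_n$, then $a\circ_{-\partial-\lambda}b=\sum_n(-\partial-\lambda)^nc_n$ with $\partial$ acting on the coefficients $c_n$, and similarly for other products and brackets. It is commutative if $a\circ_\lambda b=(-1)^{|a||b|}b\circ_{-\partial-\lambda}a$,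 and associative if $a\circ_\lambda(b\circ_\mu c)=(a\circ_\lambda b)\circ_{\lambda+\mu}c$, for all $a,b,c$. A left-symmetric conformal superalgebra $(A,\ast_\lambda)$ is a conformal superalgebra with $(a\ast_\lambda b)\ast_{\lambda+\mu}c-a\ast_\lambda(b\ast_\mu c)=(-1)^{|a||b|}\big((b\ast_\mu a)\ast_{\lambda+\mu}c-b\ast_\mu(a\ast_\lambda c)\big)$. A pre-Lie Poisson conformal superalgebra $(\mathcal{L},\circ_\lambda,\ast_\lambda)$ is a $\mathbb{Z}_2$-graded $\mathbb{C}[\partial]$-module such that $(\mathcal{L},\circ_\lambda)$ is a commutative associative conformal superalgebra, $(\mathcal{L},\ast_\lambda)$ is a left-symmetric conformal superalgebra, and for all $a,b,c$: $(a\circ_\lambda b)\ast_{\lambda+\mu}c=a\circ_\lambda(b\ast_\mu c)$ and $(a\ast_\lambda b)\circ_{\lambda+\mu}c-a\ast_\lambda(b\circ_\mu c)=(-1)^{|a||b|}\big((b\ast_\mu a)\circ_{\lambda+\mu}c-b\ast_\mu(a\circ_\lambda c)\big)$. A Lie conformal superalgebra $(A,[\cdot_\lambda\cdot])$ is a $\mathbb{Z}_2$-graded $\mathbb{C}[\partial]$-module with a $\mathbb{C}$-bilinear map $a\otimes b\mapsto[a_\lambda b]\in A[\lambda]$, $[{A_i}_\lambda A_j]\subseteq A_{i+j}[\lambda]$, such that $[(\partial a)_\lambda b]=-\lambda[a_\lambda b]$, $[a_\lambda(\partial b)]=(\partial+\lambda)[a_\lambda b]$, $[a_\lambda b]=-(-1)^{|a||b|}[b_{-\lambda-\partial}a]$,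 and $[a_\lambda[b_\mu c]]=[[a_\lambda b]_{\lambda+\mu}c]+(-1)^{|a||b|}[b_\mu[a_\lambda c]]$. A transposed Poisson conformal superalgebra (TPCSA) is a $\mathbb{Z}_2$-graded $\mathbb{C}[\partial]$-module $\mathcal{L}$ with $\circ_\lambda$ and $[\cdot_\lambda\cdot]$ such that $(\mathcal{L},\circ_\lambda)$ is a commutative associative conformal superalgebra, $(\mathcal{L},[\cdot_\lambda\cdot])$ is a Lie conformal superalgebra, and $2(a\circ_\lambda[b_\mu c])=[(a\circ_\lambda b)_{\lambda+\mu}c]+(-1)^{|a||b|}[b_\mu(a\circ_\lambda c)]$ for all $a,b,c\in\mathcal{L}$. *)

(* Defs.v *)
From HB Require Import structures.
From mathcomp Require Import all_boot all_order all_algebra.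
From mathcomp Require Import boolp classical_sets reals.
From mathcomp Require Import complex.
From mathcomp Require Import finmap monalg.

Set Implicit Arguments.
Unset Strict Implicit.
Unset Printing Implicit Defensive.

Import GRing.Theory.
Local Open Scope ring_scope.

(* A[X]: finitely supported families nat -> A, with p@_n the coefficient of   *)
(* X^n. It is again a module over the scalars of A, acting on coefficients, so *)
(* that the construction can be iterated.                                      *)
Definition modpoly (A : zmodType) := {malg A[nat]}.

HB.instance Definition _ (A : zmodType) := GRing.Zmodule.on (modpoly A).

Definition mpcoef (A : zmodType) (p : modpoly A) (n : nat) : A := p@_n.

Definition mpconst (A : zmodType) (a : A) : modpoly A := << a *g 0%N >>.

Definition mpmap (A B : zmodType) (f : A -> B) (p : modpoly A) : modpoly B :=
  \sum_(n <- msupp p) << f (mpcoef p n) *g n >>.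

(* p |-> X p *)
Definition mpmulX (A : zmodType) (p : modpoly A) : modpoly A :=
  \sum_(n <- msupp p) << mpcoef p n *g n.+1 >>.

Lemma mpcoef_map (A B : zmodType) (f : A -> B) (p : modpoly A) n :
  f 0 = 0 -> mpcoef (mpmap f p) n = f (mpcoef p n).
Proof.
move=> f0; rewrite /mpmap /mpcoef raddf_sum /=.
under eq_bigr do rewrite mcoeffU.
have [np|np] := boolP (n \in msupp p).
  rewrite (big_fsetD1 n) //= eqxx mulr1n big_seq big1 ?addr0 // => k.
  by rewrite in_fsetD1 => /andP[/negPf -> _]; rewrite mulr0n.
rewrite mcoeff_outdom // f0 big_seq big1 // => k kp.
by case: eqP => [kn|_]; rewrite ?mulr0n //; rewrite kn (negPf np) in kp.
Qed.

Lemma mpcoefP (A : zmodType) (p q : modpoly A) :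
  (forall n, mpcoef p n = mpcoef q n) -> p = q.
Proof. by move=> pq; apply/malgP. Qed.

Section ModpolyLmodule.
Variables (K : nzRingType) (A : lmodType K).

Definition mpscale (c : K) (p : modpoly A) : modpoly A := mpmap ( *:%R c) p.

Lemma mpcoef_scale c p n : mpcoef (mpscale c p) n = c *: mpcoef p n.
Proof. by rewrite mpcoef_map // scaler0. Qed.

Lemma mpcoefD (p q : modpoly A) n :
  mpcoef (p + q) n = mpcoef p n + mpcoef q n.
Proof. exact: mcoeffD. Qed.

Lemma mpscaleA a b p : mpscale a (mpscale b p) = mpscale (a * b) p.
Proof. by apply: mpcoefP => n; rewrite !mpcoef_scale scalerA. Qed.

Lemma mpscale1 : left_id 1 mpscale.
Proof. by move=> p; apply: mpcoefP => n; rewrite mpcoef_scale scale1r. Qed.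

Lemma mpscaleDr : right_distributive mpscale +%R.
Proof.
move=> c p q; apply: mpcoefP => n.
by rewrite !(mpcoef_scale, mpcoefD) scalerDr.
Qed.

Lemma mpscaleDl p : {morph mpscale^~ p : a b / a + b}.
Proof.
move=> a b; apply: mpcoefP => n.
by rewrite !(mpcoef_scale, mpcoefD) scalerDl.
Qed.

HB.instance Definition _ := GRing.Zmodule_isLmodule.Build K (modpoly A)
  mpscaleA mpscale1 mpscaleDr mpscaleDl.

End ModpolyLmodule.

(* Substitution of an operator T on V for the variable of p, the coefficients  *)
(* being carried to V by e: sum_n T^n (e p_n).                                 *)
Definition mpsubst (A V : zmodType) (T : V -> V) (e : A -> V) (p : modpoly A) :
    V :=
  \sum_(n <- msupp p) iter n T (e (mpcoef p n)).

(* A[lambda, mu] = A[lambda][mu] *)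
Definition modpoly2 (A : zmodType) := modpoly (modpoly A).

Section TwoVariables.
Variable A : zmodType.

Definition mulla : modpoly2 A -> modpoly2 A := mpmap (@mpmulX A).
Definition mulmu : modpoly2 A -> modpoly2 A := @mpmulX (modpoly A).
Definition mp2const (a : A) : modpoly2 A := mpconst (mpconst a).

(* (a op1_S b) op2_T c and a op1_S (b op2_T c), where S and T are operators on *)
(* A[lambda, mu] (multiplication by lambda, mu or lambda + mu); as products    *)
(* are linear in each argument, the outer product applies to each coefficient  *)
(* of the inner one.                                                           *)
Definition nestl (op1 op2 : A -> A -> modpoly A)
    (S T : modpoly2 A -> modpoly2 A) (a b c : A) : modpoly2 A :=
  mpsubst S (fun x => mpsubst T mp2const (op2 x c)) (op1 a b).

Definition nestr (op1 op2 : A -> A -> modpoly A)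
    (S T : modpoly2 A -> modpoly2 A) (a b c : A) : modpoly2 A :=
  mpsubst T (fun x => mpsubst S mp2const (op1 a x)) (op2 b c).

End TwoVariables.

Arguments mulla {A}.
Arguments mulmu {A}.

Section ConformalSuperalgebras.
Context {C : comNzRingType} {A : lmodType {poly C}}.
Implicit Types (G : bool -> set A) (op : A -> A -> modpoly A).
Local Open Scope classical_set_scope.

(* The derivation is the action of 'X, and the submodule condition includes    *)
(* its preserving each G i.                                                    *)
Record Z2_graded G : Prop := {
  graded0 : forall i, G i 0;
  gradedP : forall i (f : {poly C}) a b, G i a -> G i b -> G i (f *: a + b);
  graded_sum : forall a, exists a0 a1, [/\ G false a0, G true a1 & a = a0 + a1];
  graded_direct : G false `&` G true `<=` [set 0]
}.

(* The component of degree i of a for the decomposition A = G false (+) G true *)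
Definition hcomp G (i : bool) (a : A) : A :=
  xget 0 [set x | G i x /\ G (~~ i) (a - x)].

Definition koszul (i j : bool) : {poly C} := (-1) ^+ (i * j)%N.

(* The value of p at -partial - lambda *)
Definition mpflip (p : modpoly A) : modpoly A :=
  mpsubst (fun q : modpoly A => - ('X *: q) - mpmulX q) (@mpconst A) p.

Record conformal_superalgebra G op : Prop := {
  csa_graded : Z2_graded G;
  csa_linearl : forall (k : C) a a' b,
    op (k%:P *: a + a') b = k%:P *: op a b + op a' b;
  csa_linearr : forall (k : C) a b b',
    op a (k%:P *: b + b') = k%:P *: op a b + op a b';
  csa_parity : forall i j a b n, G i a -> G j b ->
    G (i (+) j) (mpcoef (op a b) n);
  csa_sesquil : forall a b, op ('X *: a) b = - mpmulX (op a b);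
  csa_sesquir : forall a b, op a ('X *: b) = 'X *: op a b + mpmulX (op a b)
}.

Definition csa_commutative G op : Prop :=
  forall i j a b, G i a -> G j b ->
    op a b = koszul i j *: mpflip (op b a).

Definition csa_associative op : Prop :=
  forall a b c, nestr op op mulla mulmu a b c
              = nestl op op mulla (mulla \+ mulmu) a b c.

Record comm_assoc_conformal_superalgebra G op : Prop := {
  ca_csa : conformal_superalgebra G op;
  ca_comm : csa_commutative G op;
  ca_assoc : csa_associative op
}.

Record left_symmetric_conformal_superalgebra G op : Prop := {
  ls_csa : conformal_superalgebra G op;
  ls_leftsym : forall i j a b c, G i a -> G j b ->
    nestl op op mulla (mulla \+ mulmu) a b c - nestr op op mulla mulmu a b c
    = koszul i j *: (nestl op op mulmu (mulla \+ mulmu) b a c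
                     - nestr op op mulmu mulla b a c)
}.

Record preLie_Poisson_conformal_superalgebra G (circ ast : A -> A -> modpoly A) :
    Prop := {
  plp_circ : comm_assoc_conformal_superalgebra G circ;
  plp_ast : left_symmetric_conformal_superalgebra G ast;
  plp_compatl : forall a b c,
    nestl circ ast mulla (mulla \+ mulmu) a b c
    = nestr circ ast mulla mulmu a b c;
  plp_compatr : forall i j a b c, G i a -> G j b ->
    nestl ast circ mulla (mulla \+ mulmu) a b c - nestr ast circ mulla mulmu a b c
    = koszul i j *: (nestl ast circ mulmu (mulla \+ mulmu) b a c
                     - nestr ast circ mulmu mulla b a c)
}.

Record Lie_conformal_superalgebra G (br : A -> A -> modpoly A) : Prop := {
  lie_csa : conformal_superalgebra G br;
  lie_skew : forall i j a b, G i a -> G j b ->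
    br a b = - (koszul i j *: mpflip (br b a));
  lie_jacobi : forall i j a b c, G i a -> G j b ->
    nestr br br mulla mulmu a b c
    = nestl br br mulla (mulla \+ mulmu) a b c
      + koszul i j *: nestr br br mulmu mulla b a c
}.

Record transposed_Poisson_conformal_superalgebra G
    (circ br : A -> A -> modpoly A) : Prop := {
  tp_circ : comm_assoc_conformal_superalgebra G circ;
  tp_lie : Lie_conformal_superalgebra G br;
  tp_compat : forall i j a b c, G i a -> G j b ->
    2%:R *: nestr circ br mulla mulmu a b c
    = nestl circ br mulla (mulla \+ mulmu) a b c
      + koszul i j *: nestr br circ mulmu mulla b a c
}.

(* a *_lambda b - (-1)^{|a||b|} b *_{-partial-lambda} a on homogeneous a, b,   *)
(* extended by linearity; see supercommutatorE.                                *)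
Definition supercommutator G op (a b : A) : modpoly A :=
  \sum_(i : bool) \sum_(j : bool)
    (op (hcomp G i a) (hcomp G j b)
     - koszul i j *: mpflip (op (hcomp G j b) (hcomp G i a))).

Lemma hcomp_homog G i j a : Z2_graded G -> G i a ->
  hcomp G j a = if j == i then a else 0.
Proof.
move=> grG Ga; have G0 := graded0 grG.
have GN k x : G k x -> G k (- x).
  by move=> Gx; have := gradedP grG (-1) Gx (G0 k); rewrite scaleN1r addr0.
have GD k x y : G k x -> G k y -> G k (x + y).
  by move=> Gx Gy; have := gradedP grG 1 Gx Gy; rewrite scale1r.
have dir k x : G k x -> G (~~ k) x -> x = 0.
  by case: k => ? ?; apply: (graded_direct grG).
apply: xget_unique => /=.
  case: eqVneq => [->|ji]; first by rewrite subrr.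
  have -> : ~~ j = i by case: j i ji {Ga} => [] [].
  by rewrite subr0.
move=> y [Gy Gay]; case: eqVneq => [ji|ji].
  subst j; apply/esym/subr0_eq; apply: (dir i) => //.
  by apply: GD => //; apply: GN.
apply: (dir j) => //.
have ij : ~~ j = i by case: j i ji {Ga Gy Gay} => [] [].
rewrite ij in Gay *.
by rewrite -[y](subKr a); apply: GD => //; apply: GN.
Qed.

Lemma supercommutatorE G op i j a b : conformal_superalgebra G op ->
  G i a -> G j b ->
  supercommutator G op a b = op a b - koszul i j *: mpflip (op b a).
Proof.
move=> csa Ga Gb; have grG := csa_graded csa.
have op0l x : op 0 x = 0.
  have := csa_linearl csa 1 0 0 x.
  by rewrite !scale1r addr0 => /(congr1 (fun t => t - op 0 x)); rewrite addrK subrr.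
have op0r x : op x 0 = 0.
  have := csa_linearr csa 1 x 0 0.
  by rewrite !scale1r addr0 => /(congr1 (fun t => t - op x 0)); rewrite addrK subrr.
have flip0 : mpflip 0 = 0 by rewrite /mpflip /mpsubst msupp0 big_seq_fset0.
rewrite /supercommutator (bigD1 i) //= (bigD1 j) //=.
rewrite !(hcomp_homog _ grG Ga) !(hcomp_homog _ grG Gb) !eqxx.
rewrite [X in _ + X + _]big1 => [|k kj].
  rewrite [X in _ + X]big1 ?addr0 // => k ki; rewrite big1 // => l _.
  rewrite (hcomp_homog _ grG Ga) (negPf ki).
  by rewrite op0l op0r flip0 scaler0 subr0.
rewrite (hcomp_homog _ grG Gb) (negPf kj).
by rewrite op0l op0r flip0 scaler0 subr0.
Qed.

End ConformalSuperalgebras.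

(* Main.v *)
Require Import Defs.
From HB Require Import structures.
From mathcomp Require Import all_boot all_order all_algebra.
From mathcomp Require Import boolp classical_sets reals complex.
From mathcomp Require Import finmap monalg.

Set Implicit Arguments.
Unset Strict Implicit.
Unset Printing Implicit Defensive.

Import GRing.Theory.
Local Open Scope ring_scope.

(* Fix operators la, lb, lc with la + lb + lc = - partial on A[lambda, mu],   *)
(* attached to three arguments a, b, c. A double product bracketed as (ab)c   *)
(* is nestl with operators la and la + lb; bracketed as a(bc), it is nestr    *)
(* with operators la and lb. Replacing a product by its flip                  *)
(* b *_{-partial-lambda} a then just exchanges the two factors, each argument *)
(* keeping its own operator. The axioms, given for (lambda, mu), hold for all *)
(* commuting la, lb by substitution. Expanding the bracket, the Jacobi        *)
(* identity is a combination of three instances of left symmetry, and the     *)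
(* transposed Poisson identity one of the two compatibility axioms and        *)
(* commutativity.                                                             *)

(** Once partial acts as -(la + lb + lc), the three arguments play symmetric roles: [weights_swap]
    and [weights_rot] permute them together with their operators. The four lemmas [nestl_sc_inner],
    [nestl_sc_outer], [nestr_sc_inner] and [nestr_sc_outer] then expand each bracket as in an
    ordinary superalgebra, and [specialization] supplies the axioms for every ordering of the
    arguments. What remains is the classical computation, with Koszul signs.

    Jacobi: its twelve terms cancel by left symmetry in (a,b;c), (b,c;a) and (a,c;b), the first two
    arguments being the exchanged ones ([jacobi_signed]). Transposed Poisson: the first
    compatibility axiom turns (a o b)*c and (a o c)*b into a o (b*c) and a o (c*b), which give one
    copy of a o [b,c]; the remaining terms b*(a o c) and c*(a o b) give a second copy by the other
    axiom at (b,c;a), read through commutativity ([compat_signed]).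

    The signs involve the parities of all three arguments, so these identities are proved for
    homogeneous elements and extended by [graded_ext]. *)

Lemma additive_bundle (U W : zmodType) (f : U -> W) :
  zmod_morphism f -> exists g : {additive U -> W}, f = g.
Proof.
move=> fB; pose g := HB.pack_for {additive U -> W} f
  (GRing.isZmodMorphism.Build U W f fB).
by exists g.
Qed.

(** * Substitution of operators into polynomials with module coefficients *)

Section Substitution.
Variables A V : zmodType.
Implicit Types (p q : modpoly A) (T D : V -> V) (e : A -> V).

Lemma modpoly_ext (W : zmodType) (f g : modpoly A -> W) :
  zmod_morphism f -> zmod_morphism g ->
  (forall a n, f << a *g n >> = g << a *g n >>) -> f =1 g.
Proof.
move=> /additive_bundle[{}f ->] /additive_bundle[{}g ->] fg p.
by rewrite (monalgE p) !raddf_sum; apply: eq_bigr => n _; exact: fg.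
Qed.

Lemma iter_zmod_morphism T n : zmod_morphism T -> zmod_morphism (iter n T).
Proof. by move=> TB x y; elim: n => //= n ->. Qed.

Lemma mpsubstB T e : zmod_morphism T -> zmod_morphism e ->
  zmod_morphism (mpsubst T e).
Proof.
move=> TB eB p q.
have TeB n : zmod_morphism (iter n T \o e).
  by move=> x y /=; rewrite eB (iter_zmod_morphism n TB).
have Te0 n : iter n T (e 0) = 0.
  by have := TeB n 0 0 => /=; rewrite !subrr.
(* All three sums are taken over one finite set; the extra terms vanish because
   [iter n T (e 0) = 0]. *)
pose d := (msupp p `|` msupp q)%fset.
have substE r : (msupp r `<=` d)%fset ->
    mpsubst T e r = \sum_(n <- d) iter n T (e (mpcoef r n)).
  move=> rd; apply: big_fset_incl => // n _ nr.
  by rewrite /mpcoef mcoeff_outdom ?Te0.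
rewrite !substE ?fsubsetUl ?fsubsetUr ?msuppB_le // -sumrB.
by apply: eq_bigr => n _; rewrite -[RHS](TeB n) /mpcoef mcoeffB.
Qed.

Lemma mpsubstU T e a n : zmod_morphism T -> zmod_morphism e ->
  mpsubst T e << a *g n >> = iter n T (e a).
Proof.
move=> TB eB; have TeB x y :
  iter n T (e (x - y)) = iter n T (e x) - iter n T (e y).
  by rewrite eB (iter_zmod_morphism n TB).
have Te0 : iter n T (e 0) = 0 by have := TeB 0 0; rewrite !subrr.
rewrite /mpsubst msuppU; case: eqP => [->|_].
  by rewrite big_seq_fset0 Te0.
by rewrite big_seq_fset1 /mpcoef mcoeffUU.
Qed.

Lemma mpsubst_const T e a : zmod_morphism T -> zmod_morphism e ->
  mpsubst T e (mpconst a) = e a.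
Proof. exact: mpsubstU. Qed.

Lemma mpsubst0 T e : mpsubst T e 0 = 0.
Proof. by rewrite /mpsubst msupp0 big_seq_fset0. Qed.

Lemma eq_mpsubst T T' e e' p : T =1 T' -> e =1 e' ->
  mpsubst T e p = mpsubst T' e' p.
Proof. by move=> /funext -> /funext ->. Qed.

Lemma mpcoef_mulX p n :
  mpcoef (mpmulX p) n = if n is m.+1 then mpcoef p m else 0.
Proof.
rewrite /mpmulX /mpcoef raddf_sum /=; under eq_bigr do rewrite mcoeffU.
case: n => [|n]; first by rewrite big1.
have [np|np] := boolP (n \in msupp p).
  rewrite (big_fsetD1 n) //= eqxx mulr1n big_seq big1 ?addr0 // => k.
  by rewrite in_fsetD1 eqSS => /andP[/negPf -> _].
rewrite mcoeff_outdom // big_seq big1 // => k kp.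
by rewrite eqSS; case: eqP => // kn; rewrite kn (negPf np) in kp.
Qed.

Lemma mpmulXB : zmod_morphism (@mpmulX A).
Proof.
move=> p q; apply: mpcoefP => n.
rewrite /mpcoef mcoeffB -!/(mpcoef _ _) !mpcoef_mulX.
by case: n => [|n]; rewrite ?subrr // /mpcoef mcoeffB.
Qed.

Lemma mpmulXU (a : A) n : mpmulX << a *g n >> = << a *g n.+1 >>.
Proof.
by apply: mpcoefP => -[|m]; rewrite mpcoef_mulX /mpcoef !mcoeffU.
Qed.

Lemma mpsubst_mulX T e p : zmod_morphism T -> zmod_morphism e ->
  mpsubst T e (mpmulX p) = T (mpsubst T e p).
Proof.
move=> TB eB; have sB := mpsubstB TB eB.
apply: (modpoly_ext (f := mpsubst T e \o @mpmulX A) (g := T \o mpsubst T e)).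
- by move=> x y /=; rewrite mpmulXB sB.
- by move=> x y /=; rewrite sB TB.
- by move=> a n /=; rewrite mpmulXU !mpsubstU.
Qed.

Lemma iter_comm T (W : zmodType) (T' : W -> W) (f : V -> W) n :
  (forall v, f (T v) = T' (f v)) -> forall v, f (iter n T v) = iter n T' (f v).
Proof. by move=> fT v; elim: n => //= n <-. Qed.

(** An additive map intertwining T and T' passes through every power of T, hence through the whole
    substitution. *)
Lemma mpsubst_comp (W : zmodType) (f : V -> W) T (T' : W -> W) e p :
  zmod_morphism f -> (forall v, f (T v) = T' (f v)) ->
  f (mpsubst T e p) = mpsubst T' (f \o e) p.
Proof.
case/additive_bundle => g -> {f} gT; rewrite /mpsubst raddf_sum.
by apply: eq_bigr => n _; exact: iter_comm.
Qed.

End Substitution.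

Lemma mpmapB (A B : zmodType) (f : A -> B) : zmod_morphism f ->
  zmod_morphism (mpmap f).
Proof.
move=> fB; have f0 : f 0 = 0 by have := fB 0 0; rewrite !subrr.
move=> p q; apply: mpcoefP => n.
rewrite /mpcoef mcoeffB -!/(mpcoef _ _) !mpcoef_map //.
by rewrite -fB /mpcoef mcoeffB.
Qed.

Lemma mpmapU (A B : zmodType) (f : A -> B) a n : f 0 = 0 ->
  mpmap f << a *g n >> = << f a *g n >>.
Proof.
move=> f0; apply: mpcoefP => m; rewrite mpcoef_map // /mpcoef !mcoeffU.
by case: eqP; rewrite ?mulr1n ?mulr0n.
Qed.

Lemma mpsubst_map (A B V : zmodType) (T : V -> V) (e : B -> V) (f : A -> B) p :
  zmod_morphism T -> zmod_morphism e -> zmod_morphism f ->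
  mpsubst T e (mpmap f p) = mpsubst T (e \o f) p.
Proof.
move=> TB eB fB; have f0 : f 0 = 0 by have := fB 0 0; rewrite !subrr.
have efB : zmod_morphism (e \o f) by move=> x y /=; rewrite fB eB.
apply: (modpoly_ext (f := mpsubst T e \o mpmap f)).
- by move=> x y /=; rewrite (mpmapB fB) (mpsubstB TB eB).
- exact: mpsubstB.
- by move=> a n /=; rewrite mpmapU // !mpsubstU.
Qed.

Lemma mpconstB (A : zmodType) : zmod_morphism (@mpconst A).
Proof. by move=> x y; rewrite /mpconst raddfB. Qed.

(** * The flip: substitution of -partial - lambda *)

Section Flip.
Variables (C : comNzRingType) (A : lmodType {poly C}).
Implicit Types (p q : modpoly A).

Let flipX (p : modpoly A) : modpoly A := - ('X *: p) - mpmulX p.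

Let flipXB : zmod_morphism flipX.
Proof.
move=> p q; rewrite /flipX scalerBr mpmulXB !opprB opprK addrACA addrC.
by rewrite [X in _ + X]addrC.
Qed.

Lemma mpflipB : zmod_morphism (@mpflip C A).
Proof. exact: (mpsubstB flipXB (@mpconstB _)). Qed.

Lemma mpmulXZ (c : {poly C}) p : mpmulX (c *: p) = c *: mpmulX p.
Proof.
apply: mpcoefP => -[|n]; rewrite mpcoef_scale !mpcoef_mulX ?scaler0 //.
by rewrite mpcoef_scale.
Qed.

Lemma scale_malgU (c : {poly C}) (a : A) n :
  c *: (<< a *g n >> : modpoly A) = << c *: a *g n >>.
Proof. by rewrite -[LHS]/(mpmap _ _) mpmapU ?scaler0. Qed.

Lemma mpconstZ (c : {poly C}) (a : A) : mpconst (c *: a) = c *: mpconst a.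
Proof. by rewrite scale_malgU. Qed.

Lemma mpflipZ (c : {poly C}) p : mpflip (c *: p) = c *: mpflip p.
Proof.
have cB (W : lmodType {poly C}) : zmod_morphism ( *:%R c : W -> W).
  by move=> x y; rewrite scalerBr.
(* Scaling is coefficientwise by definition, so it is an [mpmap]; it commutes with [flipX] because
   [{poly C}] is commutative. *)
rewrite -[c *: p]/(mpmap _ _) /mpflip mpsubst_map //; [|exact: mpconstB].
rewrite [RHS](mpsubst_comp (T' := flipX)) //.
  by apply: eq_mpsubst => //= a; exact: mpconstZ.
- exact: (cB (modpoly A)).
- by move=> v; rewrite /flipX scalerBr scalerN mpmulXZ !scalerA mulrC.
Qed.

Lemma mpflipP (f : {poly C}) p q :
  mpflip (f *: p + q) = f *: mpflip p + mpflip q.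
Proof.
by rewrite -mpflipZ; have [g ->] := additive_bundle mpflipB; rewrite raddfD.
Qed.

Lemma mpflip_mulX p :
  mpflip (mpmulX p) = - ('X *: mpflip p) - mpmulX (mpflip p).
Proof. exact: (mpsubst_mulX _ flipXB (@mpconstB _)). Qed.

Lemma mpsubstX (V : zmodType) (T D : V -> V) (e : A -> V) p :
  zmod_morphism T -> zmod_morphism D -> zmod_morphism e ->
  (forall v, D (T v) = T (D v)) -> (forall a, e ('X *: a) = D (e a)) ->
  mpsubst T e ('X *: p) = D (mpsubst T e p).
Proof.
move=> TB DB eB DT eX; rewrite -[_ *: p]/(mpmap _ _) mpsubst_map //.
  rewrite [RHS](mpsubst_comp (T' := T)) //.
  exact: eq_mpsubst.
by move=> x y; rewrite scalerBr.
Qed.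

(** If partial on coefficients becomes D under e, then -partial - lambda becomes -D - T under lambda
    -> T. All later rules for flips come from choosing D according to where the flipped product
    stands. *)
Lemma mpsubst_flip (V : zmodType) (T D : V -> V) (e : A -> V) p :
  zmod_morphism T -> zmod_morphism D -> zmod_morphism e ->
  (forall v, D (T v) = T (D v)) -> (forall a, e ('X *: a) = D (e a)) ->
  mpsubst T e (mpflip p) = mpsubst (fun v => - D v - T v) e p.
Proof.
move=> TB DB eB DT eX; have sB := mpsubstB TB eB.
rewrite (mpsubst_comp (T' := fun v => - D v - T v)) //.
  by apply: eq_mpsubst => //= a; exact: mpsubst_const.
move=> q; rewrite -(mpsubstX q TB DB eB DT eX) -(mpsubst_mulX q TB eB).
by have [g ->] := additive_bundle sB; rewrite raddfB raddfN.
Qed.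

Lemma mpflipK : involutive (@mpflip C A).
Proof.
(* Here T is [flipX] and D is the action of ['X], so -D - T is multiplication by the variable, and
   substituting the variable for itself is the identity. *)
move=> p; rewrite {1}/mpflip (mpsubst_flip (D := *:%R 'X)) //.
- rewrite (@eq_mpsubst _ _ _ (@mpmulX A) _ (@mpconst A)) //.
    apply: (modpoly_ext (g := id)) => //.
      exact: (mpsubstB (@mpmulXB _) (@mpconstB _)).
    move=> a n; rewrite mpsubstU; [|exact: mpmulXB|exact: mpconstB].
    by elim: n => //= n ->; rewrite mpmulXU.
  by move=> q; rewrite opprD !opprK addrA addNr add0r.
- by move=> x y; rewrite scalerBr.
- exact: mpconstB.
- by move=> v; rewrite scalerBr scalerN mpmulXZ.
- exact: mpconstZ.
Qed.

End Flip.

(** * Additivity, homogeneous components and Koszul signs *)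

Section Bilinear.
Variables (C : comNzRingType) (A : lmodType {poly C}).

Lemma linear_zmod_morphism (U W : lmodType {poly C}) (f : U -> W) :
  (forall (k : C) x y, f (k%:P *: x + y) = k%:P *: f x + f y) ->
  zmod_morphism f.
Proof.
move=> flin x y; have := flin (-1) y x.
by rewrite polyCN !scaleNr !scale1r addrC => ->; rewrite addrC.
Qed.

Variables (G : bool -> set A) (op : A -> A -> modpoly A).
Hypothesis csa : conformal_superalgebra G op.

Lemma csa_Bl b : zmod_morphism (op^~ b).
Proof. by apply: linear_zmod_morphism => k x y; exact: (csa_linearl csa). Qed.

Lemma csa_Br a : zmod_morphism (op a).
Proof. by apply: linear_zmod_morphism => k x y; exact: (csa_linearr csa). Qed.

End Bilinear.

Section Graded.
Variables (C : comNzRingType) (A : lmodType {poly C}).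
Variables (G : bool -> set A).
Hypothesis grG : Z2_graded G.

Lemma gradedD i x y : G i x -> G i y -> G i (x + y).
Proof. by move=> Gx Gy; have := gradedP grG 1 Gx Gy; rewrite scale1r. Qed.

Lemma gradedZ i (f : {poly C}) x : G i x -> G i (f *: x).
Proof.
by move=> Gx; have := gradedP grG f Gx (graded0 grG i); rewrite addr0.
Qed.

Lemma gradedB i x y : G i x -> G i y -> G i (x - y).
Proof.
by move=> Gx Gy; have := gradedP grG (-1) Gy Gx; rewrite scaleN1r addrC.
Qed.

Lemma hcomp_graded i a : G i (hcomp G i a) /\ G (~~ i) (a - hcomp G i a).
Proof.
have [a0 [a1 [Ga0 Ga1 ->]]] := graded_sum grG a.
(* The default value of [xget] is excluded, since the decomposition of a provides a witness. *)
rewrite /hcomp; case: xgetP => [x _ //|nex]; exfalso.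
case: i nex => [|] nex.
  by apply: (nex a1) => /=; rewrite addrK.
by apply: (nex a0) => /=; rewrite addrAC subrr add0r.
Qed.

Lemma hcomp_uniq i a x : G i x -> G (~~ i) (a - x) -> hcomp G i a = x.
Proof.
move=> Gx Gax; have [Gh Gah] := hcomp_graded i a.
have G1 : G i (hcomp G i a - x) by exact: gradedB.
have G2 : G (~~ i) (hcomp G i a - x).
  have -> : hcomp G i a - x = a - x - (a - hcomp G i a).
    by rewrite opprB [RHS]addrC subrKA.
  exact: gradedB.
apply/eqP; rewrite -subr_eq0; apply/eqP.
by case: (i) G1 G2 => ? ?; apply: (graded_direct grG).
Qed.

Lemma hcompP i (f : {poly C}) a b :
  hcomp G i (f *: a + b) = f *: hcomp G i a + hcomp G i b.
Proof.
have [Ga Ga'] := hcomp_graded i a; have [Gb Gb'] := hcomp_graded i b.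
apply: hcomp_uniq; first exact: (gradedP grG).
by rewrite opprD addrACA -scalerBr; exact: (gradedP grG).
Qed.

Lemma hcompE a : a = hcomp G false a + hcomp G true a.
Proof.
have [Ga Ga'] := hcomp_graded false a.
suff -> : hcomp G true a = a - hcomp G false a by rewrite addrC subrK.
by apply: hcomp_uniq => //; rewrite subKr.
Qed.

Lemma graded_ext (W : zmodType) (f g : A -> W) :
  zmod_morphism f -> zmod_morphism g ->
  (forall i a, G i a -> f a = g a) -> f =1 g.
Proof.
move=> /additive_bundle[{}f ->] /additive_bundle[{}g ->] fg a.
rewrite [a]hcompE !raddfD.
by rewrite (fg _ _ (hcomp_graded false a).1) (fg _ _ (hcomp_graded true a).1).
Qed.

End Graded.

Section Koszul.
Variable (C : comNzRingType).

Lemma koszulC i j : koszul i j = koszul j i :> {poly C}.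
Proof. by rewrite /koszul mulnC. Qed.

Lemma koszulDl i j k : koszul (i (+) j) k = koszul i k * koszul j k :> {poly C}.
Proof.
rewrite /koszul; case: i j k => [] [] [] /=;
  by rewrite ?mulrNN ?mulr1 ?mul1r ?expr0 ?expr1.
Qed.

Lemma koszulDr i j k : koszul i (j (+) k) = koszul i j * koszul i k :> {poly C}.
Proof. by rewrite koszulC koszulDl koszulC [koszul k i]koszulC. Qed.

Lemma koszul_sq i j : koszul i j * koszul i j = 1 :> {poly C}.
Proof. by rewrite /koszul -expr2 sqrr_sign. Qed.

(** The Koszul factor is 1 or -1, so additivity is enough to move it through f. *)
Lemma zmod_morphism_koszul (U W : lmodType {poly C}) (f : U -> W) i j u :
  zmod_morphism f -> f (koszul i j *: u) = koszul i j *: f u.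
Proof. by case/additive_bundle => g ->; exact: raddfZsign. Qed.

End Koszul.

(** * The bracket as the product of a conformal superalgebra *)

Section Supercommutator.
Variables (C : comNzRingType) (A : lmodType {poly C}).
Variables (G : bool -> set A) (op : A -> A -> modpoly A).
Hypothesis csa : conformal_superalgebra G op.
Let grG := csa_graded csa.

Lemma mpflip_graded i (p : modpoly A) :
  (forall n, G i (mpcoef p n)) -> forall n, G i (mpcoef (mpflip p) n).
Proof.
move=> Gp; pose Gs (q : modpoly A) := forall n, G i (mpcoef q n).
suff : Gs (mpflip p) by [].
rewrite /mpflip /mpsubst; apply: (big_ind Gs) => [n|q r Gq Gr n|n _].
- by rewrite /mpcoef mcoeff0; exact: (graded0 grG).
- by rewrite mpcoefD; exact: (gradedD grG).
move: (mpcoef p n) (Gp n) => a Ga; elim: n => [|n IH] k.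
  rewrite /= /mpconst /mpcoef mcoeffU; case: eqP => _ //.
  exact: (graded0 grG).
(* One more iteration of the flip operator is put in the form [f *: a + b] required by [gradedP]. *)
rewrite iterS -scaleN1r scalerA -[X in _ + X]scaleN1r mpcoefD !mpcoef_scale.
apply: (gradedP grG); first exact: IH.
apply: (gradedZ grG); rewrite mpcoef_mulX.
by case: k => [|k]; [exact: (graded0 grG)|exact: IH].
Qed.

Lemma supercommutator_linearl (k : C) a a' b :
  supercommutator G op (k%:P *: a + a') b
  = k%:P *: supercommutator G op a b + supercommutator G op a' b.
Proof.
rewrite /supercommutator scaler_sumr -big_split; apply: eq_bigr => i _ /=.
rewrite scaler_sumr -big_split; apply: eq_bigr => j _ /=.
rewrite (hcompP grG) (csa_linearl csa) (csa_linearr csa) mpflipP.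
by rewrite scalerBr scalerDr !scalerA [koszul i j * _]mulrC opprD addrACA.
Qed.

Lemma supercommutator_linearr (k : C) a b b' :
  supercommutator G op a (k%:P *: b + b')
  = k%:P *: supercommutator G op a b + supercommutator G op a b'.
Proof.
rewrite /supercommutator scaler_sumr -big_split; apply: eq_bigr => i _ /=.
rewrite scaler_sumr -big_split; apply: eq_bigr => j _ /=.
rewrite (hcompP grG) (csa_linearl csa) (csa_linearr csa) mpflipP.
by rewrite scalerBr scalerDr !scalerA [koszul i j * _]mulrC opprD addrACA.
Qed.

(** The flip exchanges the two sesquilinearity rules: it sends partial + lambda to -lambda, so the
    flipped term transforms like the direct one. *)
Lemma supercommutator_sesquil i j a b : G i a -> G j b ->
  supercommutator G op ('X *: a) b = - mpmulX (supercommutator G op a b).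
Proof.
move=> Ga Gb; have GXa := gradedZ grG 'X Ga.
rewrite (supercommutatorE csa Ga Gb) (supercommutatorE csa GXa Gb).
rewrite (csa_sesquil csa) (csa_sesquir csa) mpflipP mpflip_mulX.
rewrite addrA subrr sub0r mpmulXB mpmulXZ scalerN opprK opprB.
by rewrite [RHS]addrC.
Qed.

Lemma supercommutator_sesquir i j a b : G i a -> G j b ->
  supercommutator G op a ('X *: b)
  = 'X *: supercommutator G op a b + mpmulX (supercommutator G op a b).
Proof.
move=> Ga Gb; have GXb := gradedZ grG 'X Gb.
rewrite (supercommutatorE csa Ga Gb) (supercommutatorE csa Ga GXb).
rewrite (csa_sesquil csa) (csa_sesquir csa).
have -> : mpflip (- mpmulX (op b a))
    = 'X *: mpflip (op b a) + mpmulX (mpflip (op b a)).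
  by rewrite -scaleN1r mpflipZ mpflip_mulX scaleN1r opprD !opprK.
rewrite mpmulXB mpmulXZ scalerDr scalerBr !scalerA [koszul i j * _]mulrC.
by rewrite opprD addrACA.
Qed.

Lemma supercommutator_skew i j a b : G i a -> G j b ->
  supercommutator G op a b
  = - (koszul i j *: mpflip (supercommutator G op b a)).
Proof.
move=> Ga Gb; rewrite !(supercommutatorE csa Ga Gb, supercommutatorE csa Gb Ga).
rewrite mpflipB mpflipZ mpflipK scalerBr scalerA [koszul j i]koszulC koszul_sq.
by rewrite scale1r opprB.
Qed.

Lemma supercommutator_csa : conformal_superalgebra G (supercommutator G op).
Proof.
have Bl b : zmod_morphism ((supercommutator G op)^~ b).
  by apply: linear_zmod_morphism => k x y; exact: supercommutator_linearl.
have Br a : zmod_morphism (supercommutator G op a).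
  by apply: linear_zmod_morphism => k x y; exact: supercommutator_linearr.
have mE := @mpmulXB A.
split=> //; [exact: supercommutator_linearl|exact: supercommutator_linearr|..].
- move=> i j a b n Ga Gb; rewrite (supercommutatorE csa Ga Gb).
  rewrite /mpcoef mcoeffB -!/(mpcoef _ _) mpcoef_scale.
  apply: (gradedB grG); first exact: (csa_parity csa).
  apply: (gradedZ grG); rewrite addbC; apply: mpflip_graded => m.
  exact: (csa_parity csa).
(* Both sides are additive in a and in b, which reduces sesquilinearity to homogeneous arguments,
   where [supercommutatorE] applies. *)
- move=> a b; move: a; apply: (graded_ext grG) => [x y|x y|i a Ga].
  + by rewrite scalerBr Bl.
  + by rewrite Bl mE !opprB opprK addrC.
  move: b; apply: (graded_ext grG) => [x y|x y|j b Gb].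
  + by rewrite Br.
  + by rewrite Br mE !opprB opprK addrC.
  exact: supercommutator_sesquil Ga Gb.
- move=> a b; move: a; apply: (graded_ext grG) => [x y|x y|i a Ga].
  + by rewrite Bl.
  + by rewrite Bl mE scalerBr opprD addrACA.
  move: b; apply: (graded_ext grG) => [x y|x y|j b Gb].
  + by rewrite scalerBr Br.
  + by rewrite Br mE scalerBr opprD addrACA.
  exact: supercommutator_sesquir Ga Gb.
Qed.

End Supercommutator.

(** * Operators attached to three arguments, and flips inside double products *)

Lemma mpsubst_fB (A V : zmodType) (T : V -> V) (e f : A -> V) p :
  zmod_morphism T ->
  mpsubst T (fun x => e x - f x) p = mpsubst T e p - mpsubst T f p.
Proof.
move=> TB; rewrite /mpsubst -sumrB; apply: eq_bigr => n _.
exact: (iter_zmod_morphism n TB).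
Qed.

(** Agreement is asked only on the coefficients of p, so that their parity can be used to prove
    it. *)
Lemma eq_coef_mpsubst (A V : zmodType) (T : V -> V) (e f : A -> V) p :
  (forall n, e (mpcoef p n) = f (mpcoef p n)) -> mpsubst T e p = mpsubst T f p.
Proof. by move=> ef; apply: eq_bigr => n _; rewrite ef. Qed.

Section Weights.
Variables (C : comNzRingType) (V : lmodType {poly C}).

Record weights (la lb lc : V -> V) : Prop := {
  weights_addl : zmod_morphism la;
  weights_addr : zmod_morphism lb;
  weights_comm : forall v, la (lb v) = lb (la v);
  weights_scalel : forall v, la ('X *: v) = 'X *: la v;
  weights_scaler : forall v, lb ('X *: v) = 'X *: lb v;
  weights_sum : forall v, lc v = - ('X *: v) - la v - lb v
}.

Lemma weights_swap la lb lc : weights la lb lc -> weights lb la lc.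
Proof.
by case=> Ba Bb ab Xa Xb c; split=> // v; rewrite ?ab // c addrAC.
Qed.

(** The relation la + lb + lc = -partial is symmetric, and lc inherits additivity and the
    commutation rules from its formula in la, lb and ['X]. *)
Lemma weights_rot la lb lc : weights la lb lc -> weights lb lc la.
Proof.
case=> Ba Bb ab Xa Xb c.
have [f fE] := additive_bundle Ba; have [g gE] := additive_bundle Bb.
have cE : lc = (( \- ( *:%R 'X) \- f) \- g).
  by apply: funext => v; rewrite c fE gE.
have Bc : zmod_morphism lc.
  by move=> x y; rewrite cE; exact: raddfB.
split=> // v.
- by rewrite !c gE !raddfB !raddfN /= -gE Xb ab.
- by rewrite !c Xa Xb !scalerBr scalerN.
- by rewrite c [X in _ - X]addrAC subKr.
Qed.

Lemma weights_addD la lb lc : weights la lb lc -> zmod_morphism (la \+ lb).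
Proof. by case=> Ba Bb _ _ _ _ x y /=; rewrite Ba Bb opprD addrACA. Qed.

End Weights.

Lemma mpsubst_koszul (C : comNzRingType) (U : zmodType) (W : lmodType {poly C})
    (T : W -> W) (e : U -> W) p i j : zmod_morphism T ->
  mpsubst T (fun x => koszul i j *: e x) p = koszul i j *: mpsubst T e p.
Proof.
move=> TB; rewrite [RHS](mpsubst_comp (T' := T)) //.
  by move=> x y; rewrite scalerBr.
by move=> v; rewrite zmod_morphism_koszul.
Qed.

Section Actions.
Variables (C : comNzRingType) (A V : lmodType {poly C}) (e0 : A -> V).
Hypotheses (e0B : zmod_morphism e0) (e0X : forall a, e0 ('X *: a) = 'X *: e0 a).
Implicit Types (G : bool -> set A) (op : A -> A -> modpoly A) (T : V -> V).

Lemma actBl G op T c : conformal_superalgebra G op -> zmod_morphism T ->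
  zmod_morphism (fun x => mpsubst T e0 (op x c)).
Proof. by move=> csa TB x y; rewrite (csa_Bl csa) (mpsubstB TB e0B). Qed.

Lemma actBr G op T c : conformal_superalgebra G op -> zmod_morphism T ->
  zmod_morphism (fun x => mpsubst T e0 (op c x)).
Proof. by move=> csa TB x y; rewrite (csa_Br csa) (mpsubstB TB e0B). Qed.

Let scaleXB : zmod_morphism ( *:%R 'X : V -> V).
Proof. by move=> x y; rewrite scalerBr. Qed.

(** With [actXr], this identifies the operator D of [mpsubst_flip] when the flipped product is a
    factor of another one: partial acts as -T from the left slot and as ['X] + T from the right
    slot. *)
Lemma actXl G op T x c : conformal_superalgebra G op -> zmod_morphism T ->
  mpsubst T e0 (op ('X *: x) c) = - T (mpsubst T e0 (op x c)).
Proof.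
move=> csa TB; rewrite (csa_sesquil csa) -(mpsubst_mulX _ TB e0B).
by have [g ->] := additive_bundle (mpsubstB TB e0B); rewrite raddfN.
Qed.

Lemma actXr G op T x c : conformal_superalgebra G op -> zmod_morphism T ->
  (forall v, T ('X *: v) = 'X *: T v) ->
  mpsubst T e0 (op c ('X *: x)) =
  'X *: mpsubst T e0 (op c x) + T (mpsubst T e0 (op c x)).
Proof.
move=> csa TB TX; rewrite (csa_sesquir csa) -(mpsubst_mulX _ TB e0B).
rewrite -(mpsubstX (D := *:%R 'X) _ TB scaleXB e0B _ e0X) //.
by have [g ->] := additive_bundle (mpsubstB TB e0B); rewrite raddfD.
Qed.

Section Flips.
Variables (la lb lc : V -> V).
Hypothesis w : weights la lb lc.
Let Ba := weights_addl w.
Let Bb := weights_addr w.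

Let Bab := weights_addD w.

(** In the left slot of a product taken at la + lb, partial is -(la + lb), so -partial - la is
    lb. *)
Lemma flip_inner_l G op c p : conformal_superalgebra G op ->
  mpsubst la (fun x => mpsubst (la \+ lb) e0 (op x c)) (mpflip p)
  = mpsubst lb (fun x => mpsubst (la \+ lb) e0 (op x c)) p.
Proof.
move=> csa; rewrite (mpsubst_flip (D := fun v => - (la v + lb v))) //.
- by apply: eq_mpsubst => // v; rewrite opprK addrC addKr.
- by move=> x y; rewrite -[la _ + _]/((la \+ lb) _) Bab opprB opprK addrC.
- exact: (actBl _ csa Bab).
- have [f fE] := additive_bundle Ba.
  by move=> v; rewrite -(weights_comm w) fE [RHS]raddfN [in RHS]raddfD.
- by move=> a; exact: (actXl _ _ csa Bab).
Qed.

Lemma flip_outer_l q : mpsubst (la \+ lb) e0 (mpflip q) = mpsubst lc e0 q.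
Proof.
rewrite (mpsubst_flip (D := *:%R 'X)) //.
  by apply: eq_mpsubst => // v; rewrite (weights_sum w) /= opprD addrA.
by move=> v /=; rewrite (weights_scalel w) (weights_scaler w) scalerDr.
Qed.

(** In the right slot of a product taken at la, partial is ['X] + la, so -partial - lb is lc. *)
Lemma flip_inner_r G op a p : conformal_superalgebra G op ->
  mpsubst lb (fun x => mpsubst la e0 (op a x)) (mpflip p)
  = mpsubst lc (fun x => mpsubst la e0 (op a x)) p.
Proof.
move=> csa; rewrite (mpsubst_flip (D := fun v => 'X *: v + la v)) //.
- by apply: eq_mpsubst => // v; rewrite (weights_sum w) opprD.
- by move=> x y; rewrite scalerBr Ba opprD addrACA.
- exact: (actBr _ csa Ba).
- have [f fE] := additive_bundle Bb.
  by move=> v; rewrite (weights_comm w) -(weights_scaler w) fE raddfD.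
- by move=> x; apply: (actXr _ _ csa Ba); exact: (weights_scalel w).
Qed.

End Flips.

Lemma flip_outer_r la lb lc q : weights la lb lc ->
  mpsubst la e0 (mpflip q) = mpsubst (lb \+ lc) e0 q.
Proof. by move=> w; rewrite -(flip_outer_l (weights_rot w)) mpflipK. Qed.

End Actions.

(** * Expansion of a bracket in the inner or outer position of a double product *)

Section Nests.
Variables (C : comNzRingType) (A : lmodType {poly C}).
Let V : lmodType {poly C} := modpoly (modpoly A).
Let e0 : A -> V := @mp2const A.

Lemma mp2constB : zmod_morphism e0.
Proof. by move=> x y; rewrite /e0 /mp2const !mpconstB. Qed.

Lemma mp2constX (a : A) : e0 ('X *: a) = 'X *: e0 a.
Proof. by rewrite /e0 /mp2const !mpconstZ. Qed.

Section Twist.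
Variables (G : bool -> set A) (op : A -> A -> modpoly A).
Hypothesis csa : conformal_superalgebra G op.
Variables (la lb lc : V -> V).
Hypothesis w : weights la lb lc.
Variables (i j k : bool) (a b c : A).
Hypotheses (Ga : G i a) (Gb : G j b) (Gc : G k c).
Let Ba := weights_addl w.
Let Bb := weights_addr w.
Let Bab := weights_addD w.
Local Notation br := (supercommutator G op).

Lemma nestl_sc_inner op' : conformal_superalgebra G op' ->
  nestl br op' la (la \+ lb) a b c
  = nestl op op' la (la \+ lb) a b c
    - koszul i j *: nestl op op' lb (lb \+ la) b a c.
Proof.
move=> csa'; rewrite /nestl (supercommutatorE csa Ga Gb).
have sB := mpsubstB Ba (actBl mp2constB c csa' Bab).
rewrite sB (zmod_morphism_koszul (W := V) _ _ _ sB)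
  (flip_inner_l mp2constB w _ _ csa').
by rewrite (_ : lb \+ la = la \+ lb) //; apply: funext => v /=; rewrite addrC.
Qed.

Lemma nestl_sc_outer op' : conformal_superalgebra G op' ->
  nestl op' br la (la \+ lb) a b c
  = nestl op' op la (la \+ lb) a b c
    - koszul (i (+) j) k *: nestr op op' lc la c a b.
Proof.
move=> csa'; rewrite /nestl /nestr -(mpsubst_koszul _ _ _ _ Ba).
rewrite -(mpsubst_fB _ _ _ Ba).
apply: eq_coef_mpsubst => n.
(* The outer bracket is applied to the coefficients of the inner product, all homogeneous of degree
   [i (+) j], so one sign serves for every term. *)
have Gn : G (i (+) j) (mpcoef (op' a b) n) by exact: (csa_parity csa').
rewrite (supercommutatorE csa Gn Gc) (mpsubstB Bab mp2constB).
by rewrite (zmod_morphism_koszul (W := V) _ _ _ (mpsubstB Bab mp2constB))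
  (flip_outer_l mp2constB mp2constX w).
Qed.

Lemma nestr_sc_inner op' : conformal_superalgebra G op' ->
  nestr op' br la lb a b c
  = nestr op' op la lb a b c - koszul j k *: nestr op' op la lc a c b.
Proof.
move=> csa'; rewrite /nestr (supercommutatorE csa Gb Gc).
have sB := mpsubstB Bb (actBr mp2constB a csa' Ba).
by rewrite sB (zmod_morphism_koszul (W := V) _ _ _ sB)
  (flip_inner_r mp2constB mp2constX w _ _ csa').
Qed.

Lemma nestr_sc_outer op' : conformal_superalgebra G op' ->
  nestr br op' la lb a b c
  = nestr op op' la lb a b c
    - koszul i (j (+) k) *: nestl op' op lb (lb \+ lc) b c a.
Proof.
move=> csa'; rewrite /nestl /nestr -(mpsubst_koszul _ _ _ _ Bb).
rewrite -(mpsubst_fB _ _ _ Bb).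
apply: eq_coef_mpsubst => n.
have Gn : G (j (+) k) (mpcoef (op' b c) n) by exact: (csa_parity csa').
rewrite (supercommutatorE csa Ga Gn) (mpsubstB Ba mp2constB).
by rewrite (zmod_morphism_koszul (W := V) _ _ _ (mpsubstB Ba mp2constB))
  (flip_outer_r mp2constB mp2constX _ w).
Qed.

End Twist.
End Nests.

(** * Transfer of identities from lambda, mu to arbitrary weights *)

Section Specialization.
Variables (C : comNzRingType) (A : lmodType {poly C}).
Let V : lmodType {poly C} := modpoly (modpoly A).
Implicit Types (op : A -> A -> modpoly A).

Lemma mullaB : zmod_morphism (@mulla A).
Proof. exact: (mpmapB (@mpmulXB A)). Qed.

Lemma mulmuB : zmod_morphism (@mulmu A).
Proof. exact: (@mpmulXB (modpoly A)). Qed.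

Lemma weights_mul :
  weights (mulla : V -> V) (mulmu : V -> V)
    (fun v => - ('X *: v) - mulla v - mulmu v).
Proof.
have X0 : @mpmulX A 0 = 0 by have := @mpmulXB A 0 0; rewrite !subrr.
split=> // [||v|v|v].
- exact: mullaB.
- exact: mulmuB.
- apply: mpcoefP => n; rewrite mpcoef_map // !mpcoef_mulX.
  by case: n => [|n]; rewrite ?X0 // mpcoef_map.
- apply: mpcoefP => n.
  rewrite (mpcoef_map _ _ X0) [RHS](@mpcoef_scale _ (modpoly A)).
  rewrite [in LHS](@mpcoef_scale _ (modpoly A)) mpmulXZ.
  by rewrite (mpcoef_map _ _ X0).
- exact: mpmulXZ.
Qed.

Lemma nestl_comp (f S T S' T' : V -> V) op1 op2 a b c : zmod_morphism f ->
  (forall x, f (mp2const x) = mp2const x) ->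
  (forall v, f (S v) = S' (f v)) -> (forall v, f (T v) = T' (f v)) ->
  f (nestl op1 op2 S T a b c) = nestl op1 op2 S' T' a b c.
Proof.
move=> fB fC fS fT; rewrite /nestl (mpsubst_comp (T' := S')) //.
apply: eq_mpsubst => // x; rewrite /comp (mpsubst_comp (T' := T')) //.
exact: eq_mpsubst.
Qed.

Lemma nestr_comp (f S T S' T' : V -> V) op1 op2 a b c : zmod_morphism f ->
  (forall x, f (mp2const x) = mp2const x) ->
  (forall v, f (S v) = S' (f v)) -> (forall v, f (T v) = T' (f v)) ->
  f (nestr op1 op2 S T a b c) = nestr op1 op2 S' T' a b c.
Proof.
move=> fB fC fS fT; rewrite /nestr (mpsubst_comp (T' := T')) //.
apply: eq_mpsubst => // x; rewrite /comp (mpsubst_comp (T' := S')) //.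
exact: eq_mpsubst.
Qed.

(* The substitution lambda -> la, mu -> lb. *)
Lemma specialization (la lb lc : V -> V) : weights la lb lc ->
  exists f : {additive V -> V},
    [/\ forall x, f (mp2const x) = mp2const x,
        forall v, f (mulla v) = la (f v) & forall v, f (mulmu v) = lb (f v)].
Proof.
move=> w; have Ba := weights_addl w; have Bb := weights_addr w.
have eB := @mp2constB C A.
have sB := mpsubstB Ba eB.
have [f fE] := additive_bundle (mpsubstB Bb sB).
exists f; rewrite -fE; split=> [x|v|v].
- by rewrite !mpsubst_const.
- rewrite mpsubst_map //; last exact: mpmulXB.
  (* [mulla] acts on the coefficients of the powers of mu, so la has to be moved past the powers of
     lb. *)
  rewrite [RHS](mpsubst_comp (T' := lb)) //; last exact: (weights_comm w).
  by apply: eq_mpsubst => // p; rewrite /comp mpsubst_mulX.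
- exact: mpsubst_mulX.
Qed.

Lemma nestlBr G op1 op2 (S T : V -> V) a b :
  conformal_superalgebra G op2 -> zmod_morphism S -> zmod_morphism T ->
  zmod_morphism (nestl op1 op2 S T a b).
Proof.
move=> csa SB TB x y; rewrite -(mpsubst_fB _ _ _ SB).
by apply: eq_mpsubst => // z; exact: (actBr (@mp2constB C A) z csa TB).
Qed.

Lemma nestrBr G op1 op2 (S T : V -> V) a b :
  conformal_superalgebra G op1 -> conformal_superalgebra G op2 ->
  zmod_morphism S -> zmod_morphism T -> zmod_morphism (nestr op1 op2 S T a b).
Proof.
move=> csa1 csa2 SB TB x y; rewrite /nestr (csa_Br csa2).
exact: (mpsubstB TB (actBr (@mp2constB C A) a csa1 SB)).
Qed.

Lemma koszul_morph (U W : lmodType {poly C}) (f : U -> W) i j x y z t :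
  zmod_morphism f -> x - y = koszul i j *: (z - t) ->
  f x - f y = koszul i j *: (f z - f t).
Proof. by move=> fB xyzt; rewrite -!fB xyzt zmod_morphism_koszul. Qed.

(** With two products, one statement covers both left symmetry and the second compatibility
    axiom. *)
Lemma leftsym_weights op1 op2 i j a b c (la lb lc : V -> V) :
  weights la lb lc ->
  (nestl op1 op2 mulla (mulla \+ mulmu) a b c : V)
    - nestr op1 op2 mulla mulmu a b c
  = koszul i j *: ((nestl op1 op2 mulmu (mulla \+ mulmu) b a c : V)
                   - nestr op1 op2 mulmu mulla b a c) ->
  (nestl op1 op2 la (la \+ lb) a b c : V) - nestr op1 op2 la lb a b c
  = koszul i j *: ((nestl op1 op2 lb (lb \+ la) b a c : V)
                   - nestr op1 op2 lb la b a c).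
Proof.
move=> /specialization[f [fC fl fm]].
have fB : zmod_morphism f by exact: raddfB.
have flm v : f ((mulla \+ mulmu) v) = (la \+ lb) (f v).
  by rewrite raddfD fl fm.
move/(koszul_morph fB).
rewrite (nestl_comp _ _ _ _ _ fB fC fl flm)
  (nestr_comp _ _ _ _ _ fB fC fl fm).
rewrite (nestl_comp _ _ _ _ _ fB fC fm flm)
  (nestr_comp _ _ _ _ _ fB fC fm fl).
move=> ->; rewrite (_ : lb \+ la = la \+ lb) //.
by apply: funext => v /=; rewrite addrC.
Qed.

Lemma nest_assoc_weights op1 op2 (la lb lc : V -> V) a b c : weights la lb lc ->
  nestl op1 op2 mulla (mulla \+ mulmu) a b c
  = nestr op1 op2 mulla mulmu a b c ->
  nestl op1 op2 la (la \+ lb) a b c = nestr op1 op2 la lb a b c.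
Proof.
move=> /specialization[f [fC fl fm]] /(congr1 f).
have fB : zmod_morphism f by exact: raddfB.
have flm v : f ((mulla \+ mulmu) v) = (la \+ lb) (f v) by rewrite raddfD fl fm.
by rewrite (nestl_comp _ _ _ _ _ fB fC fl flm)
  (nestr_comp _ _ _ _ _ fB fC fl fm).
Qed.

End Specialization.

(** * The underlying signed identities in a module *)

Lemma subr_swap (U : zmodType) (x y z t : U) : x - y = z - t -> x - z = y - t.
Proof.
move/eqP; rewrite subr_eq => /eqP ->.
by rewrite addrAC [z - t]addrC addrK addrC.
Qed.

Lemma jacobi_cancel (U : zmodType) (x1 x2 y1 y2 z1 z2 w1 w2 v1 v2 q1 q2 : U) :
  z1 - x1 = z2 - v1 -> y1 - v2 = y2 - w2 -> q1 - x2 = q2 - w1 ->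
  x1 - x2 - (y1 - y2) = z1 - z2 - (w1 - w2) + (v1 - v2 - (q1 - q2)).
Proof.
move=> /subr_swap -> /subr_swap -> /subr_swap ->.
by rewrite !opprB [RHS]addrACA !subrKA addrACA [RHS]addrACA [- x2 - v2]addrC.
Qed.

Section Jacobi.
Variables (K : comNzRingType) (U : lmodType K) (s t u : K).
Hypotheses (ss : s * s = 1) (tt : t * t = 1).

(** The signs s, t, u belong to the pairs ab, ac, bc. The letters x, y, z, w, v, q stand for a(bc),
    (bc)a, (ab)c, c(ab), b(ac), (ac)b; index 2 marks the same bracketing with the inner factors
    exchanged. The hypotheses are left symmetry in (a,b;c), (b,c;a) and (a,c;b). *)
Lemma jacobi_signed (x1 x2 y1 y2 z1 z2 w1 w2 v1 v2 q1 q2 : U) :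
  z1 - x1 = s *: (z2 - v1) -> y1 - v2 = u *: (y2 - w2) ->
  q1 - x2 = t *: (q2 - w1) ->
  x1 - u *: x2 - (s * t) *: (y1 - u *: y2)
  = z1 - s *: z2 - (t * u) *: (w1 - s *: w2)
    + s *: (v1 - t *: v2 - (s * u) *: (q1 - t *: q2)).
Proof.
move=> hz hy hq; rewrite !scalerBr !scalerA.
have -> : s * (s * u) = u by rewrite mulrA ss mul1r.
have -> : t * u * s = s * t * u by rewrite mulrC mulrA.
apply: jacobi_cancel.
- by rewrite hz scalerBr.
- by rewrite -!scalerA -!scalerBr hy.
- by rewrite [t * u]mulrC -!scalerA -!scalerBr hq.
Qed.

(** Here p1, p2, q2, r1 are a o (b*c), a o (c*b), c*(a o b), b*(a o c). The hypothesis is the second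
    compatibility axiom at (b,c;a), with a moved to the left of each circ product. *)
Lemma compat_signed (p1 p2 q2 r1 : U) :
  (s * t) *: p1 - t *: r1 = u *: ((s * t) *: p2 - s *: q2) ->
  2%:R *: (p1 - u *: p2)
  = p1 - (t * u) *: q2 + s *: (r1 - (s * u) *: p2).
Proof.
move=> h; have {}h : p1 - u *: p2 = s *: r1 - (t * u) *: q2.
  apply: subr_swap; have := congr1 ( *:%R (s * t)) h.
  have stst : s * t * (s * t) = 1 by rewrite mulrACA ss tt mulr1.
  have stus : s * t * u * s = t * u by rewrite mulrC !mulrA ss mul1r.
  rewrite !scalerBr !scalerA stst scale1r -(mulrA s) tt mulr1 => ->.
  by rewrite mulrAC stst mul1r stus.
(* Of the two copies of [p1 - u *: p2], one is kept and the other is replaced using h. *)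
rewrite scaler_nat mulr2n {2}h.
rewrite scalerBr scalerA [s * (s * u)]mulrA ss mul1r.
by rewrite addrACA [RHS]addrACA [- (t * u *: q2) - _]addrC.
Qed.

End Jacobi.

(** * Commutativity inside double products *)

Section Commutative.
Variables (C : comNzRingType) (A : lmodType {poly C}).
Let V : lmodType {poly C} := modpoly (modpoly A).
Variables (G : bool -> set A) (circ op : A -> A -> modpoly A).
Hypotheses (ca : comm_assoc_conformal_superalgebra G circ)
  (csa : conformal_superalgebra G op).
Let csac := ca_csa ca.
Let grG := csa_graded csac.

(** Since this bracket vanishes, the bracket expansions applied to circ itself become the exchange
    rules [nestl_comm_outer] and [nestr_comm_inner]. *)
Lemma supercommutator_comm : supercommutator G circ = fun _ _ => 0.
Proof.
apply: funext => a; apply: funext => b.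
rewrite /supercommutator big1 // => i _; rewrite big1 // => j _.
have Ga := (hcomp_graded grG i a).1; have Gb := (hcomp_graded grG j b).1.
by rewrite (ca_comm ca Ga Gb) subrr.
Qed.

Variables (la lb lc : V -> V).
Hypothesis w : weights la lb lc.
Variables (i j k : bool) (a b c : A).
Hypotheses (Ga : G i a) (Gb : G j b) (Gc : G k c).

Lemma nestl_comm_outer :
  nestl op circ la (la \+ lb) a b c
  = koszul (i (+) j) k *: (nestr circ op lc la c a b : V).
Proof.
apply/subr0_eq; rewrite -(nestl_sc_outer csac w Ga Gb Gc csa).
rewrite supercommutator_comm /nestl.
have [f ->] := additive_bundle (weights_addl w).
rewrite /mpsubst big1 // => n _; rewrite -/(mpsubst _ _ 0) mpsubst0.
by elim: n => //= n ->; rewrite raddf0.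
Qed.

Lemma nestr_comm_inner :
  nestr op circ la lb a b c = koszul j k *: (nestr op circ la lc a c b : V).
Proof.
apply/subr0_eq; rewrite -(nestr_sc_inner csac w a Gb Gc csa).
by rewrite supercommutator_comm /nestr mpsubst0.
Qed.

End Commutative.

(** * The Jacobi and transposed Poisson identities *)

Section PreLiePoisson.
Variables (C : comNzRingType) (A : lmodType {poly C}).
Let V : lmodType {poly C} := modpoly (modpoly A).
Variables (G : bool -> set A) (circ ast : A -> A -> modpoly A).
Hypothesis plp : preLie_Poisson_conformal_superalgebra G circ ast.
Let ca := plp_circ plp.
Let csac := ca_csa ca.
Let csa := ls_csa (plp_ast plp).
Let grG := csa_graded csa.
Let csab := supercommutator_csa csa.
Local Notation br := (supercommutator G ast).

Section Homogeneous.
Variables (la lb lc : V -> V).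
Hypothesis w : weights la lb lc.
Variables (i j k : bool) (a b c : A).
Hypotheses (Ga : G i a) (Gb : G j b) (Gc : G k c).

Lemma jacobi_homog :
  nestr br br la lb a b c
  = nestl br br la (la \+ lb) a b c
    + koszul i j *: (nestr br br lb la b a c : V).
Proof.
(* Each ordering of a, b, c gets its permuted weights: w1 serves b, c, a; w2 serves c, a, b; the
   primed versions exchange the first two, so w2' serves a, c, b. *)
have w1 := weights_rot w; have w2 := weights_rot w1.
have w' := weights_swap w; have w1' := weights_swap w1.
have w2' := weights_swap w2.
rewrite (nestr_sc_outer csa w Ga Gb Gc csab) (nestr_sc_inner csa w a Gb Gc csa).
rewrite (nestl_sc_inner csa w1 a Gb Gc csa).
rewrite (nestl_sc_outer csa w Ga Gb Gc csab) (nestl_sc_inner csa w c Ga Gb csa).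
rewrite (nestr_sc_inner csa w2 c Ga Gb csa).
rewrite (nestr_sc_outer csa w' Gb Ga Gc csab)
  (nestr_sc_inner csa w' b Ga Gc csa).
rewrite (nestl_sc_inner csa w2' b Ga Gc csa).
rewrite koszulDr koszulDl koszulDr [koszul j i]koszulC.
apply: jacobi_signed; try exact: koszul_sq.
- exact: (leftsym_weights w (ls_leftsym (plp_ast plp) c Ga Gb)).
- exact: (leftsym_weights w1 (ls_leftsym (plp_ast plp) a Gb Gc)).
- exact: (leftsym_weights w2' (ls_leftsym (plp_ast plp) b Ga Gc)).
Qed.

Lemma compat_homog :
  2%:R *: (nestr circ br la lb a b c : V)
  = nestl circ br la (la \+ lb) a b c
    + koszul i j *: (nestr br circ lb la b a c : V).
Proof.
have w1 := weights_rot w; have w2 := weights_rot w1.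
have w' := weights_swap w; have w1' := weights_swap w1.
have w2' := weights_swap w2.
rewrite (nestr_sc_inner csa w a Gb Gc csac).
rewrite (nestl_sc_outer csa w Ga Gb Gc csac).
rewrite (nestr_sc_outer csa w' Gb Ga Gc csac).
rewrite (nest_assoc_weights w (plp_compatl plp a b c)).
(* After this both (a o b)*c and (a o c)*b have become products a o (..), the two terms of a o
   [b,c]. *)
rewrite (nest_assoc_weights w2' (plp_compatl plp a c b)).
rewrite koszulDr koszulDl [koszul j i]koszulC.
apply: compat_signed; try exact: koszul_sq.
(* The axiom at (b,c;a) has a as the last factor of its circ products; the rewrites below bring a to
   the front, at the cost of signs. *)
have := leftsym_weights w1 (plp_compatr plp a Gb Gc).
rewrite (nestl_comm_outer ca csa w1 Gb Gc Ga)
  (nestl_comm_outer ca csa w1' Gc Gb Ga).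
rewrite (nestr_comm_inner ca csa w1 b Gc Ga)
  (nestr_comm_inner ca csa w1' c Gb Ga).
rewrite !koszulDl [koszul j i]koszulC [koszul k i]koszulC.
by rewrite [koszul i k * koszul i j]mulrC.
Qed.

End Homogeneous.

(** This is the shape, as a function of c, of the right-hand sides of both identities. *)
Let linB (f g : A -> V) (s : {poly C}) : zmod_morphism f -> zmod_morphism g ->
  zmod_morphism (fun c => f c + s *: g c).
Proof. by move=> fB gB x y; rewrite fB gB scalerBr opprD addrACA. Qed.

Let Bla := @mullaB C A.
Let Bmu := @mulmuB C A.
Let Blm := weights_addD (weights_mul A).

Lemma supercommutator_lie : Lie_conformal_superalgebra G br.
Proof.
split; first exact: csab; first exact: supercommutator_skew.
(* Only a and b are given as homogeneous, while the expansion also uses the parity of c; additivity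
   in c allows the reduction. *)
move=> i j a b c Ga Gb; move: c; apply: (graded_ext grG) => [x y|x y|k c Gc].
- exact: (nestrBr a b csab csab Bla Bmu).
- exact: (linB _ (nestlBr br a b csab Bla Blm) (nestrBr b a csab csab Bmu Bla)).
exact: (jacobi_homog (weights_mul A) Ga Gb Gc).
Qed.

Theorem preLie_Poisson_transposed :
  transposed_Poisson_conformal_superalgebra G circ br.
Proof.
split; first exact: ca; first exact: supercommutator_lie.
move=> i j a b c Ga Gb; move: c; apply: (graded_ext grG) => [x y|x y|k c Gc].
- by rewrite (nestrBr a b csac csab Bla Bmu) scalerBr.
- exact: (linB _ (nestlBr circ a b csab Bla Blm)
    (nestrBr b a csab csac Bmu Bla)).
exact: (compat_homog (weights_mul A) Ga Gb Gc).
Qed.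

End PreLiePoisson.

Theorem proposition4p11 (R : realType) (L : lmodType {poly R[i]})
    (G : bool -> set L) (circ ast : L -> L -> modpoly L) :
  preLie_Poisson_conformal_superalgebra G circ ast ->
  transposed_Poisson_conformal_superalgebra G circ (supercommutator G ast).
Proof. exact: preLie_Poisson_transposed. Qed.
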